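(* Let $R = k[x_1,\dots,x_n]$ be a polynomial ring over a field $k$, and let $I\subseteq R$ be the edge ideal of a hypergraph on the vertices $x_1,\dots,x_n$ which contains a good leaf. Then (i) the functions $t\mapsto\operatorname{depth} R/I^t$ and $t\mapsto\operatorname{depth} R/\overline{I^t}$ are non-increasing for all $t \ge 1$; (ii) the functions $t\mapsto\operatorname{reg} R/I^t$ and $t\mapsto\operatorname{reg} R/\overline{I^t}$ are non-decreasing for all $t \ge 1$.
   Context: A hypergraph is a collection of sets, called edges, which are subsets of a vertex set. The edge ideal of a hypergraph $\mathcal H$ on the vertices $x_1,\dots,x_n$ is the ideal $I(\mathcal H)$ of $R$ generated by the monomials $\prod_{x\in F}x$, where $F$ runs over the edges of $\mathcal H$. An edge $F$ of $\mathcal H$ is a good leaf if the intersections of $F$ with the other edges of $\mathcal H$ form a chain with respect to containment. $\overline{I^t}$ denotes the integral closure of the ideal $I^t$. $R$ has the standard grading and $\mathfrak m=(x_1,\dots,x_n)$. For a finitely generated graded $R$-module $M$ with local cohomology modules $H^i_{\mathfrak m}(M)$, $\operatorname{depth} M := \min\{ i \mid H^i_{\mathfrak m}(M) \neq 0\}$ and $\operatorname{reg} M := \max\{i+j \mid H^i_{\mathfrak m}(M)_j \neq 0\}$ (Castelnuovo-Mumford regularity). *)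

(* Defs.v *)
From HB Require Import structures.
From mathcomp Require Import all_boot all_order all_algebra fraction.
From mathcomp Require Import mpoly.
From mathcomp Require Import classical_sets constructive_ereal.

Set Implicit Arguments.
Unset Strict Implicit.
Unset Printing Implicit Defensive.

Import Order.TTheory GRing.Theory Num.Theory.
Local Open Scope ring_scope.

Section Hypergraphs.
Variable n : nat.

(* A hypergraph on n vertices is its set of edges E : {set {set 'I_n}}. *)
Definition good_leaf (E : {set {set 'I_n}}) (F : {set 'I_n}) : bool :=
  (F \in E) &&
  [forall G in E :\ F, forall H in E :\ F,
     (F :&: G \subset F :&: H) || (F :&: H \subset F :&: G)].

End Hypergraphs.

Section Ideals.
Variables (k : fieldType) (n : nat).
Local Notation R := {mpoly k[n]}.

Definition ideal_span (S : set R) : set R := fun f =>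
  exists (r : nat) (c g : 'I_r -> R),
    (forall i, S (g i)) /\ f = \sum_(i < r) c i * g i.

Definition ideal_mul (I J : set R) : set R :=
  ideal_span (fun f => exists a b : R, [/\ I a, J b & f = a * b]).

Fixpoint ideal_exp (I : set R) (t : nat) : set R :=
  if t is s.+1 then ideal_mul I (ideal_exp I s) else setT.

Definition integral_closure (I : set R) : set R := fun f =>
  exists (d : nat) (a : nat -> R),
    [/\ (0 < d)%N,
        forall i, (1 <= i <= d)%N -> ideal_exp I i (a i)
      & f ^+ d + \sum_(1 <= i < d.+1) a i * f ^+ (d - i) = 0].

Definition sqfree (s : {set 'I_n}) : R := \prod_(i in s) 'X_i.

Definition edge_ideal (E : {set {set 'I_n}}) : set R :=
  ideal_span (fun f => exists2 F, F \in E & f = sqfree F).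

End Ideals.

(* Local cohomology of R/J with support in m = (x_1, ..., x_n), for an ideal J,
   as the cohomology of the Cech complex of R/J,
     C^p = \bigoplus_(#|s| = p) (R/J)_(x_s),   x_s = \prod_(i in s) x_i.
   By exactness of localization (R/J)_(x_s) = R_(x_s) / J_(x_s), where R_(x_s)
   and J_(x_s) are taken inside the fraction field of R: a p-cochain is
   represented by a family c of fractions of which only the components c s with
   #|s| = p matter, and c s counts as zero when it lies in J_(x_s). *)
Section LocalCohomology.
Variables (k : fieldType) (n : nat).
Local Notation R := {mpoly k[n]}.
Local Notation K := {fraction R}.

(* J_(x_s); in particular R_(x_s) for J = setT. *)
Definition localize (J : set R) (s : {set 'I_n}) : set K := fun u =>
  exists (f : R) (N : nat),
    J f /\ u = tofrac f / tofrac (sqfree k s) ^+ N.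

(* The degree j component of R_(x_s). *)
Definition localize_deg (j : int) (s : {set 'I_n}) : set K := fun u =>
  exists (f : R) (N d : nat),
    [/\ f \is d.-homog, d%:Z = j + (N * #|s|)%:Z
      & u = tofrac f / tofrac (sqfree k s) ^+ N].

Definition cech_diff (c : {set 'I_n} -> K) (s : {set 'I_n}) : K :=
  \sum_(i in s) (-1) ^+ #|[set l in s | (l < i)%N]| * c (s :\ i).

Definition cech_cocycle (J : set R) (p : nat) (c : {set 'I_n} -> K) : Prop :=
  (forall s : {set 'I_n}, #|s| = p -> localize setT s (c s)) /\
  (forall s : {set 'I_n}, #|s| = p.+1 -> localize J s (cech_diff c s)).

(* For p = 0 there is no condition on b, and cech_diff b set0 = 0. *)
Definition cech_coboundary (J : set R) (p : nat) (c : {set 'I_n} -> K) : Prop :=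
  exists b : {set 'I_n} -> K,
    (forall s : {set 'I_n}, #|s|.+1 = p -> localize setT s (b s)) /\
    (forall s : {set 'I_n}, #|s| = p -> localize J s (c s - cech_diff b s)).

(* H^i_m(R/J) <> 0 *)
Definition loc_cohom_neq0 (J : set R) (i : nat) : Prop :=
  exists c, cech_cocycle J i c /\ ~ cech_coboundary J i c.

(* H^i_m(R/J)_j <> 0, for a homogeneous ideal J *)
Definition loc_cohom_deg_neq0 (J : set R) (i : nat) (j : int) : Prop :=
  exists c, [/\ cech_cocycle J i c,
                forall s : {set 'I_n}, #|s| = i -> localize_deg j s (c s)
              & ~ cech_coboundary J i c].

(* depth R/J and reg R/J as extended integers. When R/J = 0 the sets below are
   empty, and depth R/J = +oo, reg R/J = -oo. *)
Definition depth_quot (J : set R) : \bar int :=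
  @infimum _ (\bar int) +oo%E
    (fun v => exists i : nat, loc_cohom_neq0 J i /\ v = (i%:Z)%:E).

Definition reg_quot (J : set R) : \bar int :=
  @supremum _ (\bar int) -oo%E
    (fun v => exists (i : nat) (j : int),
       loc_cohom_deg_neq0 J i j /\ v = (i%:Z + j)%:E).

End LocalCohomology.

(* Main.v *)
From HB Require Import structures.
Require Import Defs.
From mathcomp Require Import all_boot all_order all_algebra fraction.
From mathcomp Require Import mpoly.
From mathcomp Require Import boolp classical_sets constructive_ereal.
From mathcomp Require Import zify.

(** Let [J] and [J'] be monomial ideals and [x^b] a monomial with
    [J = J' : x^b]. Local cohomology of [R/J] is graded by the exponents [a] in
    Z^n, and in Takayama's description its piece of degree [a] does not change
    when the negative entries of [a] vary. Adding [b_i] to the nonnegative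
    entries of [a] only therefore turns the degree [a] strand of the Cech
    complex of [R/J] into a degree strand of the Cech complex of [R/J'], of
    total degree at least as large. So a nonzero class in [H^i(R/J)_j] yields
    one in [H^i(R/J')_j'] for some [j' >= j]: the depth of [R/J'] is at most
    that of [R/J], and its regularity at least that of [R/J]. This is
    [shift_cohomology], with consequences [shift_depth_le] and [shift_reg_le].
    For each set [T] of negative coordinates there is a chain map [shift_up T b]
    from the Cech complex of [R/J] to that of [R/J'] and a chain map
    [shift_down T b] back, whose composite is the projection on the exponents
    negative exactly on [T]; these projections add up to the identity.

    It remains to exhibit [J_t = J_(t+1) : x_F] for a good leaf [F], both for
    [J_t = I^t] and for its integral closure. If [x_F x^m] is divisible by a
    product of [t+1] edges, then some factor can be removed so that the rest
    divides [x^m]: [F] itself if it occurs, otherwise an edge [G] with [F :&: G]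
    largest in the chain ([good_leaf_colon]). For integral closures, [x^m] is
    integral over [I^t] if and only if [x^(dm)] lies in [I^(td)] for some
    [d > 0], and the first case is applied [d] times ([good_leaf_integral_colon]).

    The description of the integral closure of a monomial ideal by its
    monomials is [integral_closure_level]. That such monomials span integral
    elements comes from the Rees algebra: [f] is integral over an ideal exactly
    when [f T] is integral over its Rees algebra, so that integral elements are
    closed under subtraction. Conversely, to see that each monomial of an
    integral [f] is integral, coefficients are enlarged to a polynomial ring in
    [u_1, ..., u_n]; the substitution [x_i |-> u_i x_i] preserves integrality and
    scales distinct monomials by distinct factors, so that all monomials of [f]
    but one can be eliminated ([isolate_monomial]). *)

Set Implicit Arguments.
Unset Strict Implicit.
Unset Printing Implicit Defensive.

Import Order.TTheory GRing.Theory Num.Theory.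
Local Open Scope ring_scope.

(** * Monomial ideals *)

Section MonomialIdeals.
Variables (A : comNzRingType) (n : nat).
Implicit Types (S : 'X_{1..n} -> Prop) (f g : {mpoly A[n]}).

Definition monideal S : set {mpoly A[n]} := fun f => forall m, m \in msupp f -> S m.

Definition upclosed S := forall m m', S m -> S (m + m')%MM.

Lemma upclosed_le S m m' : upclosed S -> (m <= m')%MM -> S m -> S m'.
Proof. by move=> hS le_mm' /(hS _ (m' - m)%MM); rewrite addmC submK. Qed.

Lemma monideal0 S : monideal S 0.
Proof. by move=> m; rewrite mcoeff_msupp mcoeff0 eqxx. Qed.

Lemma monidealD S f g : monideal S f -> monideal S g -> monideal S (f + g).
Proof. by move=> hf hg m /msuppD_le; rewrite mem_cat => /orP[/hf|/hg]. Qed.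

Lemma monidealN S f : monideal S f -> monideal S (- f).
Proof. by move=> hf m; rewrite (perm_mem (msuppN f)) => /hf. Qed.

Lemma monideal_sum S (J : Type) (r : seq J) (P : pred J) (F : J -> {mpoly A[n]}) :
  (forall j, P j -> monideal S (F j)) -> monideal S (\sum_(j <- r | P j) F j).
Proof.
move=> hF; elim/big_ind: _ => //; first exact: monideal0.
by move=> ? ?; apply: monidealD.
Qed.

Lemma monidealM S S' S'' f g :
    (forall m m', S m -> S' m' -> S'' (m + m')%MM) ->
  monideal S f -> monideal S' g -> monideal S'' (f * g).
Proof.
by move=> hM hf hg m /msuppM_le/allpairsP[[m1 m2]/= [/hf h1 /hg h2 ->]]; apply: hM.
Qed.

Lemma monidealMl S f g : upclosed S -> monideal S g -> monideal S (f * g).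
Proof.
by move=> hS; apply: (@monidealM (fun=> True)) => // m m' _; rewrite addmC; apply: hS.
Qed.

Lemma monidealZ S (c : A) f : monideal S f -> monideal S (c *: f).
Proof. by move=> hf m /msuppZ_le /hf. Qed.

Lemma monidealX S m : S m -> monideal S 'X_[m].
Proof. by move=> Sm m'; rewrite msuppX inE => /eqP ->. Qed.

Lemma mcoeffMXE (f : {mpoly A[n]}) m m' :
  (f * 'X_[m'])@_m = if (m' <= m)%MM then f@_(m - m') else 0.
Proof.
case: ifP => [le|nle]; first by rewrite -[in LHS](submK le) addmC mcoeffMX.
apply: memN_msupp_eq0; apply/negP; rewrite (perm_mem (msuppMX _ _)) => /mapP[q _ E].
by move: nle; rewrite E lem_addr.
Qed.

Definition mrestrict (p : pred 'X_{1..n}) f : {mpoly A[n]} :=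
  \sum_(m <- msupp f | p m) f@_m *: 'X_[m].

Lemma mcoeff_mrestrict p f m : (mrestrict p f)@_m = if p m then f@_m else 0.
Proof.
rewrite /mrestrict linear_sum /=.
under eq_bigr do rewrite mcoeffZ mcoeffX -mulr_natr mul1r.
have [mf|nmf] := boolP (m \in msupp f); last first.
  rewrite (memN_msupp_eq0 nmf) if_same big_seq_cond big1 // => m' /andP[m'f _].
  by case: eqP m'f nmf => [->->//|]; rewrite mulr0.
rewrite -big_filter; case: ifP => pm.
  rewrite (bigD1_seq m) ?mem_filter ?pm ?filter_uniq ?msupp_uniq //= eqxx mulr1.
  by rewrite big1 ?addr0 // => m' /negPf ->; rewrite mulr0.
rewrite big_seq big1 // => m'; rewrite mem_filter => /andP[pm' _].
by case: eqP pm' => [->|_ _]; rewrite ?pm ?mulr0.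
Qed.

Lemma monideal_mrestrict S p f : monideal S f -> monideal S (mrestrict p f).
Proof.
move=> hf m; rewrite mcoeff_msupp mcoeff_mrestrict; case: ifP => _.
  by rewrite -mcoeff_msupp => /hf.
by rewrite eqxx.
Qed.

Lemma mrestrictD p f g : mrestrict p (f + g) = mrestrict p f + mrestrict p g.
Proof.
by apply/mpolyP => m; rewrite mcoeffD !mcoeff_mrestrict mcoeffD; case: ifP; rewrite ?addr0.
Qed.

Lemma mrestrictMX p f m' :
  mrestrict p (f * 'X_[m']) = mrestrict (fun m => p (m + m')%MM) f * 'X_[m'].
Proof.
apply/mpolyP => m; rewrite mcoeff_mrestrict !mcoeffMXE mcoeff_mrestrict.
by case: ifP => pm; case: ifP => // le; rewrite submK ?pm.
Qed.

Lemma eq_mrestrict p q f : {in msupp f, p =1 q} -> mrestrict p f = mrestrict q f.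
Proof.
move=> pq; apply/mpolyP => m; rewrite !mcoeff_mrestrict.
have [/pq->//|nmf] := boolP (m \in msupp f).
by rewrite (memN_msupp_eq0 nmf) !if_same.
Qed.

Lemma mrestrict_all p f : {in msupp f, p =1 predT} -> mrestrict p f = f.
Proof. by move/eq_mrestrict->; apply/mpolyP => m; rewrite mcoeff_mrestrict. Qed.

Lemma msupp_mrestrict p f m : m \in msupp (mrestrict p f) -> p m /\ m \in msupp f.
Proof. by rewrite !mcoeff_msupp mcoeff_mrestrict; case: ifP; rewrite ?eqxx. Qed.

Lemma mpolyX_divide (e : 'X_{1..n}) f : {in msupp f, forall m, (e <= m)%MM} ->
  exists2 g, f = g * 'X_[e] & forall m, m \in msupp g -> (m + e)%MM \in msupp f.
Proof.
move=> hf; pose g := \sum_(m <- msupp f) f@_m *: 'X_[m - e].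
have fE : f = g * 'X_[e].
  rewrite {1}(mpolyE f) /g mulr_suml; apply: eq_big_seq => m /hf le.
  by rewrite -scalerAl -mpolyXD submK.
by clearbody g; exists g => // m; rewrite fE !mcoeff_msupp addmC mcoeffMX.
Qed.

End MonomialIdeals.

(** * Laurent polynomials in the fraction field *)

Section Laurent.
Variables (k : fieldType) (n : nat).
Local Notation R := {mpoly k[n]}.
Local Notation K := {fraction R}.
Local Notation full := (finset.setTfor 'I_n).
Implicit Types (s T : {set 'I_n}) (f g : R) (b m : 'X_{1..n}) (u v : K).

Definition sqfree_mnm s : 'X_{1..n} := [multinom (i \in s : nat) | i < n].

Lemma sqfreeE s : sqfree k s = 'X_[sqfree_mnm s].
Proof.
rewrite /sqfree mprodXE; congr 'X_[_]; apply/mnmP => i.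
rewrite mnm_sumE mnmE.
have [si|si] := boolP (i \in s).
  rewrite (bigD1 i) //= mnm1E eqxx big1 // => j /andP[_ /negPf ne].
  by rewrite mnm1E ne.
by rewrite big1 // => j js; rewrite mnm1E; case: eqP js si => // -> ->.
Qed.

Lemma sqfreeX s N : sqfree k s ^+ N = 'X_[sqfree_mnm s *+ N].
Proof. by rewrite sqfreeE mpolyXn. Qed.

Lemma mpolyX_neq0 m : 'X_[m] != 0 :> R.
Proof. by rewrite -msupp_eq0 msuppX. Qed.

Definition den s N : K := tofrac (sqfree k s) ^+ N.

Lemma denE s N : den s N = tofrac 'X_[sqfree_mnm s *+ N].
Proof. by rewrite /den -tofracXn sqfreeX. Qed.

Lemma den_neq0 s N : den s N != 0.
Proof. by rewrite denE tofrac_eq0 mpolyX_neq0. Qed.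

Lemma eq_frac s N f s' N' f' :
  tofrac f / den s N = tofrac f' / den s' N' <->
  f * 'X_[sqfree_mnm s' *+ N'] = f' * 'X_[sqfree_mnm s *+ N].
Proof.
rewrite !denE; split=> [/eqP|E]; last first.
  by apply/eqP; rewrite eqr_div -?denE ?den_neq0 // !denE -!tofracM tofrac_eq E.
by rewrite eqr_div -?denE ?den_neq0 // !denE -!tofracM tofrac_eq => /eqP.
Qed.

Lemma frac_raise s N M f : tofrac f / den s N = tofrac (f * 'X_[sqfree_mnm s *+ M]) / den s (N + M).
Proof.
apply/eq_frac; rewrite -mulrA -mpolyXD; congr (_ * 'X_[_]).
by apply/mnmP => i; rewrite mnmDE !mulmnE addnC mulnDr.
Qed.

Lemma frac_widen N f s : tofrac f / den s N =
  tofrac (f * 'X_[sqfree_mnm (~: s) *+ N]) / den full N.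
Proof.
apply/eq_frac; rewrite -mulrA -mpolyXD; congr (_ * 'X_[_]).
apply/mnmP => i; rewrite mnmDE !mulmnE !mnmE !inE.
by case: (i \in s); rewrite /= ?mul0n ?mul1n ?addn0.
Qed.

(** The condition on the Laurent monomial [x^m / x_s^N] that its exponents are
    negative on [T] and at least those of [b] off [T]. For [b = 0] this says that
    [T] is the set of its negative coordinates. It is phrased on [m] and [N] so
    that no type of Laurent exponents is needed; the clause [i \in s] records
    that an exponent outside [s] is never negative. *)
Definition window T b s N m := [forall i : 'I_n,
  if i \in T then (i \in s) && (m i < N)%N
  else ((if i \in s then N else 0) + b i <= m i)%N].

(** Two fractions representing one Laurent polynomial have the same Laurent
    monomials, and the window only looks at those: after clearing denominators
    both sides keep the same terms of one polynomial. This makes the projection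
    on a window well defined. *)
Lemma mrestrict_window_eq T b s N f s' N' f' :
  tofrac f / den s N = tofrac f' / den s' N' ->
  tofrac (mrestrict (window T b s N) f) / den s N =
  tofrac (mrestrict (window T b s' N') f') / den s' N'.
Proof.
move=> /eq_frac E; apply/eq_frac; apply/mpolyP => m.
have := congr1 (mcoeff m) E; rewrite !mcoeffMXE !mcoeff_mrestrict.
case: ifP => le'; case: ifP => le h; last by [].
- rewrite h; congr (if _ then _ else _); apply: eq_forallb => i.
  have {le'} := mnm_lepP le' i; have {le} := mnm_lepP le i.
  rewrite !mnmBE !mulmnE !mnmE.
  by case: (i \in T); case: (i \in s); case: (i \in s');
     rewrite /= ?mul0n ?mul1n ?subn0; lia.
- by rewrite h if_same.
- by rewrite -h if_same.
Qed.

(** A representation over the denominator [x_1 ... x_n] is chosen for each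
    Laurent polynomial, so that [wproj] is a function on the whole fraction field
    and can be composed with cochains. *)
Definition full_rep (u : K) : R * nat :=
  xget (0, 0%N) (fun x : R * nat => u = tofrac x.1 / den full x.2).
Definition wproj T b (u : K) : K :=
  tofrac (mrestrict (window T b full (full_rep u).2) (full_rep u).1) / den full (full_rep u).2.

Lemma wprojE T b s N f :
  wproj T b (tofrac f / den s N) = tofrac (mrestrict (window T b s N) f) / den s N.
Proof.
apply: mrestrict_window_eq; rewrite /full_rep; case: xgetP => [x _ <- //|].
move=> /(_ (f * 'X_[sqfree_mnm (~: s) *+ N], N)); case; exact: frac_widen.
Qed.

Definition laurent : set K := localize setT full.

Lemma localizeP (J : set R) s u : localize J s u <->
  exists2 f, J f & exists N, u = tofrac f / den s N.
Proof. by split=> [[f [N [? ?]]]|[f ? [N ?]]]; exists f => //; exists N. Qed.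

Lemma localize_laurent J s u : localize J s u -> laurent u.
Proof.
case/localizeP => f _ [N ->]; apply/localizeP.
by exists (f * 'X_[sqfree_mnm (~: s) *+ N]) => //; exists N; exact: frac_widen.
Qed.

Lemma localizeT s u : localize setT s u -> localize (monideal (fun=> True)) s u.
Proof. by case/localizeP => f _ [N ->]; apply/localizeP; exists f => //; exists N. Qed.

Lemma localize0 (S : 'X_{1..n} -> Prop) s : localize (monideal S) s (0 : K).
Proof.
apply/localizeP; exists 0; first exact: monideal0.
by exists 0%N; rewrite tofrac0 mul0r.
Qed.

Lemma common_den s N N' f g :
  tofrac f / den s N + tofrac g / den s N' =
  tofrac (f * 'X_[sqfree_mnm s *+ N'] + g * 'X_[sqfree_mnm s *+ N]) / den s (N + N').
Proof.
by rewrite (frac_raise s N N') (frac_raise s N' N) (addnC N') -mulrDl -tofracD.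
Qed.

Lemma localizeD (S : 'X_{1..n} -> Prop) s u v : upclosed S ->
  localize (monideal S) s u -> localize (monideal S) s v ->
  localize (monideal S) s (u + v).
Proof.
move=> hS /localizeP[f Jf [N ->]] /localizeP[g Jg [N' ->]].
apply/localizeP; rewrite common_den.
exists (f * 'X_[sqfree_mnm s *+ N'] + g * 'X_[sqfree_mnm s *+ N]); last by exists (N + N')%N.
by apply: monidealD; rewrite mulrC; apply: monidealMl.
Qed.

Lemma localizeN (S : 'X_{1..n} -> Prop) s u :
  localize (monideal S) s u -> localize (monideal S) s (- u).
Proof.
case/localizeP => f Jf [N ->]; apply/localizeP; exists (- f).
  exact: monidealN.
by exists N; rewrite tofracN mulNr.
Qed.

Lemma wprojD T b u v : laurent u -> laurent v -> wproj T b (u + v) = wproj T b u + wproj T b v.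
Proof.
move=> /localizeP[f _ [N ->]] /localizeP[g _ [N' ->]].
rewrite common_den (frac_raise _ N N' f) (frac_raise _ N' N g).
by rewrite (addnC N') !wprojE mrestrictD tofracD mulrDl.
Qed.

(** Each Laurent monomial has exactly one set of negative coordinates. *)
Lemma wproj_sum u : laurent u -> \sum_T wproj T 0 u = u.
Proof.
move=> /localizeP[f _ [N ->]]; under eq_bigr do rewrite wprojE.
rewrite -mulr_suml -rmorph_sum /=; congr (tofrac _ / _).
apply/mpolyP => m; rewrite linear_sum /=.
under eq_bigr do rewrite mcoeff_mrestrict.
rewrite -big_mkcond (big_pred1 [set i | (m i < N)%N]%SET) // => T /=.
apply/forallP/eqP => [h|-> i]; last by rewrite !inE mnm0E; case: ltnP => //=; lia.
apply/setP => i; move: (h i); rewrite !inE mnm0E.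
by case: (i \in T) => /=; lia.
Qed.

Definition mnm_off b T : 'X_{1..n} := [multinom if i \in T then 0%N else b i | i < n].

(** [shift_up T b] adds [b] off [T] to the exponents that are negative exactly
    on [T], and kills the others; [shift_down T b] undoes this, killing the
    exponents that are not reached. *)
Definition shift_up T b (u : K) : K := tofrac 'X_[mnm_off b T] * wproj T 0 u.
Definition shift_down T b (u : K) : K := wproj T b u / tofrac 'X_[mnm_off b T].

Lemma shift_upD T b u v : laurent u -> laurent v ->
  shift_up T b (u + v) = shift_up T b u + shift_up T b v.
Proof. by move=> hu hv; rewrite /shift_up wprojD ?mulrDr. Qed.

Lemma shift_downD T b u v : laurent u -> laurent v ->
  shift_down T b (u + v) = shift_down T b u + shift_down T b v.
Proof. by move=> hu hv; rewrite /shift_down wprojD ?mulrDl. Qed.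

Lemma shift_upK T b u : laurent u -> shift_down T b (shift_up T b u) = wproj T 0 u.
Proof.
move=> /localizeP[f _ [N ->]]; rewrite /shift_down /shift_up wprojE mulrA -tofracM.
rewrite mulrC wprojE mulrC [_ * mrestrict _ _]mulrC mrestrictMX mrestrict_all.
  by rewrite tofracM mulrAC mulfK // tofrac_eq0 mpolyX_neq0.
move=> m /msupp_mrestrict[/forallP w _] /=; apply/forallP => i; move: (w i).
by rewrite mnmDE !mnmE; case: (i \in T) => //=; rewrite ?addn0 // leq_add2r.
Qed.

(** The translation from [S] to [S'] is by the whole of [b], whereas [shift_up]
    leaves out its part on [T]. A surviving monomial has negative exponents on
    [T], so [T] is contained in [s] and the missing part is a unit of [R_(x_s)]:
    it is absorbed by multiplying numerator and denominator by a power of [x_s]. *)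
Lemma shift_up_localize (S S' : 'X_{1..n} -> Prop) T b s u :
    upclosed S' -> (forall m, S m -> S' (m + b)%MM) ->
  localize (monideal S) s u -> localize (monideal S') s (shift_up T b u).
Proof.
move=> upS' SS' /localizeP[f Jf [N ->]]; rewrite /shift_up wprojE mulrA -tofracM.
(* the exponent [mdeg b] bounds all the entries of [b] *)
set g := mrestrict _ _; rewrite (frac_raise _ _ (mdeg b)).
apply/localizeP; eexists; last by eexists.
move=> m; rewrite mulrC mulrA -mpolyXD mulrC (perm_mem (msuppMX _ _)).
case/mapP=> q /msupp_mrestrict[/forallP w fq] ->.
apply: (upclosed_le upS') (SS' _ (Jf _ fq)); apply/mnm_lepP => i.
move: (w i); rewrite !mnmDE !mulmnE !mnmE addnC.
case: (i \in T) => [/andP[-> _]|_]; last by lia.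
suff : (b i <= mdeg b)%N by lia.
by rewrite mdegE (bigD1 i) //= leq_addr.
Qed.

(** Here the part of [b] on [T] is available in excess, which is harmless
    because [S'] is closed under multiples. *)
Lemma shift_down_localize (S S' : 'X_{1..n} -> Prop) T b s u :
    upclosed S' -> (forall m, S' (m + b)%MM -> S m) ->
  localize (monideal S') s u -> localize (monideal S) s (shift_down T b u).
Proof.
move=> upS' S'S /localizeP[f Jf [N ->]]; rewrite /shift_down wprojE.
have [|g gE hg] := @mpolyX_divide _ _ (mnm_off b T) (mrestrict (window T b s N) f).
  move=> m /msupp_mrestrict[/forallP w _]; apply/mnm_lepP => i.
  by move: (w i); rewrite !mnmE; case: (i \in T) => //; lia.
rewrite gE tofracM mulrAC mulfK ?tofrac_eq0 ?mpolyX_neq0 //.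
apply/localizeP; exists g; last by exists N.
move=> m /hg /msupp_mrestrict[_ /Jf h]; apply: S'S; apply: upclosed_le h => //.
by apply/mnm_lepP => i; rewrite !mnmDE !mnmE; case: (i \in T); lia.
Qed.

Lemma shift_up_deg T b j s u :
  localize_deg j s u -> localize_deg (j + (mdeg (mnm_off b T))%:Z) s (shift_up T b u).
Proof.
case=> f [N [d [hf dE ->]]]; rewrite -/(den s N) /shift_up wprojE mulrA -tofracM.
exists ('X_[mnm_off b T] * mrestrict (window T 0 s N) f), N, (mdeg (mnm_off b T) + d)%N.
split=> //; last lia.
apply: dhomogM; first by rewrite dhomogX.
apply/dhomogP => m /msupp_mrestrict[_]; exact/dhomogP.
Qed.

End Laurent.

(** * Cech cohomology of monomial ideals related by a colon *)

Section CechMaps.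
Variables (k : fieldType) (n : nat) (F : {fraction {mpoly k[n]}} -> {fraction {mpoly k[n]}}).
Hypothesis FD : forall u v, laurent u -> laurent v -> F (u + v) = F u + F v.

Lemma laurent0 : laurent (0 : {fraction {mpoly k[n]}}).
Proof. exact: (localize_laurent (localize0 k (fun=> True) finset.set0)). Qed.

Lemma laurentN (u : {fraction {mpoly k[n]}}) : laurent u -> laurent (- u).
Proof. by move=> /localizeT /localizeN /localize_laurent. Qed.

Lemma laurentD (u v : {fraction {mpoly k[n]}}) : laurent u -> laurent v -> laurent (u + v).
Proof. by move=> /localizeT hu /localizeT hv; apply: localize_laurent (localizeD _ hu hv). Qed.

Lemma additive0 : F 0 = 0.
Proof. by apply: (addrI (F 0)); rewrite -FD ?addr0 //; exact: laurent0. Qed.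

Lemma additiveN u : laurent u -> F (- u) = - F u.
Proof.
move=> hu; apply: (addrI (F u)); rewrite -FD //; last exact: laurentN.
by rewrite !subrr additive0.
Qed.

Lemma additive_sign e u : laurent u -> F ((-1) ^+ e * u) = (-1) ^+ e * F u.
Proof.
by move=> hu; rewrite -signr_odd !mulr_sign; case: ifP => // _; apply: additiveN.
Qed.

Lemma laurent_sign e (u : {fraction {mpoly k[n]}}) : laurent u -> laurent ((-1) ^+ e * u).
Proof. by rewrite -signr_odd mulr_sign; case: ifP => // _; apply: laurentN. Qed.

Lemma cech_diff_map (c : {set 'I_n} -> {fraction {mpoly k[n]}}) (s : {set 'I_n}) :
  (forall i, i \in s -> laurent (c (s :\ i)%SET)) ->
  laurent (cech_diff c s) /\ F (cech_diff c s) = cech_diff (F \o c) s.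
Proof.
move=> hc; rewrite /cech_diff.
apply: (big_rec2 (fun x y => laurent x /\ F x = y)).
  by split; [exact: laurent0|exact: additive0].
move=> i x y /hc hi [hx <-]; have h := laurent_sign _ hi.
by split; [exact: laurentD|rewrite FD // additive_sign].
Qed.

End CechMaps.

Section CechCohomology.
Variables (k : fieldType) (n : nat).
Local Notation K := {fraction {mpoly k[n]}}.
Implicit Types (S : 'X_{1..n} -> Prop) (c : {set 'I_n} -> K) (F : K -> K).

Lemma card_setD1 (s : {set 'I_n}) i : i \in s -> #|(s :\ i)%SET|.+1 = #|s|.
Proof. by move=> si; rewrite (cardsD1 i s) si. Qed.

Lemma map_cochain_diff F c (s : {set 'I_n}) p :
    (forall u v, laurent u -> laurent v -> F (u + v) = F u + F v) ->
    (forall s' : {set 'I_n}, #|s'| = p -> localize setT s' (c s')) -> #|s| = p.+1 ->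
  laurent (cech_diff c s) /\ F (cech_diff c s) = cech_diff (F \o c) s.
Proof.
move=> FD hc sp; apply: cech_diff_map => // i /card_setD1 si.
by apply: localize_laurent (hc _ _); move: si; rewrite sp => -[].
Qed.

Lemma map_cocycle S S' F p c :
    (forall u v, laurent u -> laurent v -> F (u + v) = F u + F v) ->
    (forall s u, localize setT s u -> localize setT s (F u)) ->
    (forall s u, localize (monideal S) s u -> localize (monideal S') s (F u)) ->
  cech_cocycle (monideal S) p c -> cech_cocycle (monideal S') p (F \o c).
Proof.
move=> FD FT FS [hc hd]; split=> s sp; first exact/FT/hc.
by have [_ <-] := map_cochain_diff FD hc sp; apply/FS/hd.
Qed.

Lemma map_coboundary S S' F p c :
    (forall u v, laurent u -> laurent v -> F (u + v) = F u + F v) ->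
    (forall s u, localize setT s u -> localize setT s (F u)) ->
    (forall s u, localize (monideal S) s u -> localize (monideal S') s (F u)) ->
    (forall s : {set 'I_n}, #|s| = p -> laurent (c s)) ->
  cech_coboundary (monideal S) p c -> cech_coboundary (monideal S') p (F \o c).
Proof.
move=> FD FT FS hc [b [hb hd]]; exists (F \o b); split=> s sp; first exact/FT/hb.
have [lb <-] : laurent (cech_diff b s) /\ F (cech_diff b s) = cech_diff (F \o b) s.
  by apply: cech_diff_map => // i /card_setD1 si; apply/localize_laurent/hb; rewrite si.
rewrite /= -(additiveN FD lb) -FD; [exact/FS/hd|exact: hc|exact: laurentN].
Qed.

Lemma coboundaryD S p c c' : upclosed S ->
  cech_coboundary (monideal S) p c -> cech_coboundary (monideal S) p c' ->
  cech_coboundary (monideal S) p (fun s => c s + c' s).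
Proof.
move=> upS [b [hb hd]] [b' [hb' hd']]; exists (fun s => b s + b' s); split=> s sp.
  have /localizeT h := hb _ sp; have /localizeT h' := hb' _ sp.
  have [//|f _ [N ->]] := (localizeP _ _ _).1 (localizeD _ h h').
  by apply/localizeP; exists f => //; exists N.
have -> : cech_diff (fun s => b s + b' s) s = cech_diff b s + cech_diff b' s.
  by rewrite /cech_diff -big_split; apply: eq_bigr => i _; rewrite mulrDr.
by rewrite opprD addrACA; apply: localizeD; [|exact: hd|exact: hd'].
Qed.

Lemma coboundary_sum S p (J : finType) (c : J -> {set 'I_n} -> K) : upclosed S ->
  (forall j, cech_coboundary (monideal S) p (c j)) ->
  cech_coboundary (monideal S) p (fun s => \sum_j c j s).
Proof.
move=> upS hc; elim: (index_enum J) => [|j r IHr].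
  exists (fun=> 0); split=> s _.
    by apply/localizeP; exists 0 => //; exists 0%N; rewrite tofrac0 mul0r.
  rewrite big_nil /cech_diff big1 ?subr0; first exact: localize0.
  by move=> i _; rewrite mulr0.
have [b [hb hd]] := coboundaryD upS (hc j) IHr.
by exists b; split=> // s sp; rewrite big_cons; apply: hd.
Qed.

Lemma shift_up_localizeT T b s u : localize setT s u -> localize setT s (shift_up T b u : K).
Proof.
move=> /localizeT /(@shift_up_localize _ _ _ (fun=> True) T b _ _ (fun _ _ _ => I) (fun _ _ => I)).
by case/localizeP => f _ [N ->]; apply/localizeP; exists f => //; exists N.
Qed.

Lemma shift_down_localizeT T b s u : localize setT s u -> localize setT s (shift_down T b u : K).
Proof.
move=> /localizeT /(@shift_down_localize _ _ (fun=> True) (fun=> True) T b _ _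
  (fun _ _ _ => I) (fun _ _ => I)).
by case/localizeP => f _ [N ->]; apply/localizeP; exists f => //; exists N.
Qed.

(** If all images [shift_up T b \o c] were coboundaries, applying
    [shift_down T b] and adding up over [T] would make [c] a coboundary. *)
Lemma shift_cohomology S S' b p c :
    upclosed S -> upclosed S' -> (forall m, S m <-> S' (m + b)%MM) ->
    cech_cocycle (monideal S) p c -> ~ cech_coboundary (monideal S) p c ->
  exists T, cech_cocycle (monideal S') p (shift_up T b \o c) /\
    ~ cech_coboundary (monideal S') p (shift_up T b \o c).
Proof.
move=> upS upS' SS' hc nc.
have lc (s : {set 'I_n}) : #|s| = p -> laurent (c s) by move=> /hc.1 /localize_laurent.
apply: contra_notP nc => /forallNP h.
have {}h T : cech_coboundary (monideal S) p (shift_down T b \o (shift_up T b \o c)).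
  have /not_andP[[]|/contrapT] := h T.
    apply: map_cocycle hc; [exact: shift_upD|exact: shift_up_localizeT|].
    by move=> s u; apply: shift_up_localize => // m /SS'.
  apply: map_coboundary; [exact: shift_downD|exact: shift_down_localizeT| |].
    by move=> s u; apply: shift_down_localize => // m /SS'.
  by move=> s sp; apply/localize_laurent/shift_up_localizeT/hc.1.
have [b' [hb hd]] := coboundary_sum upS h; exists b'; split=> // s sp.
have <- : \sum_T shift_down T b (shift_up T b (c s)) = c s; last exact: hd.
by rewrite -[RHS](wproj_sum (lc _ sp)); apply: eq_bigr => T _; apply/shift_upK/lc.
Qed.

Variables (S S' : 'X_{1..n} -> Prop) (b : 'X_{1..n}).
Hypotheses (upS : upclosed S) (upS' : upclosed S') (SS' : forall m, S m <-> S' (m + b)%MM).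

Lemma shift_loc_cohom p : loc_cohom_neq0 (monideal S : set {mpoly k[n]}) p ->
  loc_cohom_neq0 (monideal S' : set {mpoly k[n]}) p.
Proof.
by case=> c [hc nc]; have [T h] := shift_cohomology upS upS' SS' hc nc; exists (shift_up T b \o c).
Qed.

(** The degree rises by the degree of the part of [b] off [T], hence the
    inequality between [j] and [j']. *)
Lemma shift_loc_cohom_deg p j : loc_cohom_deg_neq0 (monideal S : set {mpoly k[n]}) p j ->
  exists2 j', (j <= j')%R & loc_cohom_deg_neq0 (monideal S' : set {mpoly k[n]}) p j'.
Proof.
case=> c [hc dc nc]; have [T [h h']] := shift_cohomology upS upS' SS' hc nc.
exists (j + (mdeg (mnm_off b T))%:Z); first by lia.
by exists (shift_up T b \o c); split=> // s /dc; apply: shift_up_deg.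
Qed.

End CechCohomology.

(** * Suprema and infima of sets of integers among extended integers *)

Section Extrema.
Local Open Scope classical_set_scope.
Implicit Types A B : set (\bar int).

Lemma natset_min (P : set nat) : P !=set0 -> exists2 i, P i & forall j, P j -> (i <= j)%N.
Proof.
move=> [i0 Pi0]; have ex : exists i, `[< P i >] by exists i0; apply/asboolP.
have [i /asboolP Pi min] := ex_minnP ex; exists i => // j Pj.
by apply: min; apply/asboolP.
Qed.

(** [supremum] falls back on its default value when no supremum exists, so
    existence is needed to compare two of them. A set of integers that is bounded
    above has a maximum, at the least distance to the bound; an unbounded one has
    supremum [+oo]. *)
Lemma supremums_fin_neq0 A : A !=set0 -> (forall v, A v -> exists z, v = z%:E) ->
  supremums A !=set0.
Proof.
move=> A0 Afin; have [[M hM]|unbd] := pselect (exists M : int, forall z, A z%:E -> z <= M).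
  have [|d [z [Az dE]] dmin] := @natset_min (fun d => exists z : int, A z%:E /\ z = M - d%:Z).
    have [v Av] := A0; have [z vE] := Afin v Av; subst v.
    have := hM z Av => le_zM; exists `|M - z|%N, z; split=> //; lia.
  exists z%:E; split=> [v Av|y]; last exact.
  have [z' vE] := Afin v Av; subst v; rewrite lee_fin; have := hM z' Av => le_zM.
  have : (d <= `|M - z'|)%N by apply: dmin; exists z'; split=> //; lia.
  by lia.
exists +oo%E; split=> [v _|[y| |] hy]; rewrite ?leey //.
  by case: unbd; exists y => z /hy; rewrite lee_fin.
have [v Av] := A0; have := hy v Av; have [z ->] := Afin v Av.
by [].
Qed.

Lemma supremum_le A B : (forall v, A v -> exists z, v = z%:E) ->
    (forall v, B v -> exists z, v = z%:E) ->
  (forall v, A v -> exists2 w, B w & (v <= w)%E) ->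
  (supremum -oo A <= supremum -oo B)%E.
Proof.
move=> Afin Bfin AB; rewrite {1}/supremum; case: ifPn => [_|/set0P A0]; first exact: leNye.
have B0 : B !=set0 by have [v /AB[w Bw _]] := A0; exists w.
case: xgetP => [x _ [_ hx]|/(_ _)]; last by have [x hx] := supremums_fin_neq0 A0 Afin => /(_ x).
apply: hx => v /AB[w Bw]; move/le_trans; apply.
by apply: ge_supremum_Nmem => //; exact: supremums_fin_neq0.
Qed.

Lemma infimums_nat_neq0 A : A !=set0 -> (forall v, A v -> exists i : nat, v = i%:Z%:E) ->
  infimums A !=set0.
Proof.
move=> [v Av] Anat; have [i vE] := Anat v Av; subst v.
have [|j Aj jmin] := @natset_min (fun j => A j%:Z%:E); first by exists i.
exists j%:Z%:E; split=> [w Aw|y]; last exact.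
by have [l wE] := Anat w Aw; subst w; rewrite lee_fin lez_nat; apply: jmin.
Qed.

Lemma infimum_le A B : (forall v, A v -> exists i : nat, v = i%:Z%:E) ->
    (forall v, B v -> exists i : nat, v = i%:Z%:E) -> A `<=` B ->
  (infimum +oo B <= infimum +oo A)%E.
Proof.
move=> Anat Bnat AB; rewrite {2}/infimum; case: ifPn => [_|/set0P A0]; first exact: leey.
have B0 : B !=set0 by have [v /AB] := A0; exists v.
case: xgetP => [x _ [_ hx]|]; last by have [x hx] := infimums_nat_neq0 A0 Anat => /(_ x).
by apply: hx => v /AB Bv; apply: le_infimum_Nmem => //; exact: infimums_nat_neq0.
Qed.
End Extrema.

(** * Depth and regularity under a colon by a monomial *)

Section Monotonicity.
Variables (k : fieldType) (n : nat) (S S' : 'X_{1..n} -> Prop) (b : 'X_{1..n}).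
Hypotheses (upS : upclosed S) (upS' : upclosed S') (SS' : forall m, S m <-> S' (m + b)%MM).

Lemma shift_depth_le :
  (depth_quot (monideal S' : set {mpoly k[n]}) <= depth_quot (monideal S : set {mpoly k[n]}))%E.
Proof.
apply: infimum_le => [v [i [_ ->]]|v [i [_ ->]]|v [i [h ->]]]; try by exists i.
by exists i; split=> //; apply: shift_loc_cohom h.
Qed.

Lemma shift_reg_le :
  (reg_quot (monideal S : set {mpoly k[n]}) <= reg_quot (monideal S' : set {mpoly k[n]}))%E.
Proof.
apply: supremum_le => [v [i [j [_ ->]]]|v [i [j [_ ->]]]|v [i [j [h ->]]]];
  try by exists (i%:Z + j).
have [j' le_jj' h'] := shift_loc_cohom_deg upS upS' SS' h.
by exists (i%:Z + j')%:E; [exists i, j'|rewrite lee_fin lerD2l].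
Qed.
End Monotonicity.

(** * Powers of monomial ideals *)

(** The sets of exponents of the powers of a monomial ideal: [level i] stands for
    the [i]-th power, and [levelD] and [level_split] say that the product of the
    [i]-th and [j]-th powers is the [(i + j)]-th. *)
Record graded_family n := GradedFamily {
  level :> nat -> 'X_{1..n} -> Prop;
  level0 : forall m, level 0 m;
  levelD : forall i j m m', level i m -> level j m' -> level (i + j) (m + m')%MM;
  level_split : forall i j m, level (i + j) m ->
    exists m1 m2, [/\ m = (m1 + m2)%MM, level i m1 & level j m2] }.

Section Filtration.
Variables (n : nat) (W : graded_family n).

Lemma level_up i : upclosed (W i).
Proof. by move=> m m' Wm; rewrite -(addn0 i); apply: levelD => //; apply: level0. Qed.

Fact veronese_level0 t m : W (t * 0)%N m.
Proof. by rewrite muln0; apply: level0. Qed.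
Fact veronese_levelD t i j m m' : W (t * i)%N m -> W (t * j)%N m' -> W (t * (i + j))%N (m + m')%MM.
Proof. by rewrite mulnDr; apply: levelD. Qed.
Fact veronese_split t i j m : W (t * (i + j))%N m ->
    exists m1 m2, [/\ m = (m1 + m2)%MM, W (t * i)%N m1 & W (t * j)%N m2].
Proof. by rewrite mulnDr; apply: level_split. Qed.
(** The powers of the [t]-th power of an ideal form again such a family. *)
Definition veronese t : graded_family n :=
  GradedFamily (veronese_level0 t) (@veronese_levelD t) (@veronese_split t).
End Filtration.

Section IdealPowers.
Variables (k : fieldType) (n : nat).
Local Notation R := {mpoly k[n]}.

Lemma ideal_span_monideal (P : set R) S : upclosed S ->
    (forall g, P g -> monideal S g) ->
    (forall m, S m -> exists2 g, P g & exists h, 'X_[m] = h * g) ->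
  ideal_span P = monideal S.
Proof.
move=> upS PS SP; apply/predeqP => f; split.
  case=> r [c [g [Pg ->]]]; apply: monideal_sum => i _; apply: monidealMl => //.
  exact/PS/Pg.
move=> Sf; pose mf (i : 'I_(size (msupp f))) := tnth (in_tuple (msupp f)) i.
have mfS i : S (mf i) by apply/Sf/mem_tnth.
have /choice[g hg] i : exists gh : R * R, P gh.1 /\ 'X_[mf i] = gh.2 * gh.1.
  by have [g Pg [h hE]] := SP _ (mfS i); exists (g, h).
exists (size (msupp f)), (fun i => f@_(mf i) *: (g i).2), (fun i => (g i).1).
split=> [i|]; first exact: (hg i).1.
rewrite {1}(mpolyE f) -{1}[msupp f]/(val (in_tuple (msupp f))) big_tuple.
by apply: eq_bigr => i _; rewrite -scalerAl -(hg i).2.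
Qed.

Lemma ideal_mul_level (W : graded_family n) i j :
  ideal_mul (monideal (W i) : set R) (monideal (W j)) = monideal (W (i + j)%N).
Proof.
apply: ideal_span_monideal; first exact: level_up.
  by move=> g [a [b [ha hb ->]]]; apply: monidealM ha hb; apply: levelD.
move=> m /level_split[m1 [m2 [-> h1 h2]]]; exists ('X_[m1] * 'X_[m2]).
  by exists 'X_[m1], 'X_[m2]; split=> //; apply: monidealX.
by exists 1; rewrite mpolyXD mul1r.
Qed.

Lemma ideal_exp_level (W : graded_family n) t :
  ideal_exp (monideal (W 1%N) : set R) t = monideal (W t).
Proof.
elim: t => [|t /= ->]; last by rewrite ideal_mul_level.
by apply/predeqP => f; split=> // _ m _; apply: level0.
Qed.
End IdealPowers.

(** * Edge ideals and good leaves *)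

Section EdgeIdeal.
Variables (n : nat) (E : {set {set 'I_n}}).
Implicit Types (G F : {set 'I_n}) (Gs : seq {set 'I_n}).

Definition edge_prod Gs : 'X_{1..n} := [multinom (\sum_(G <- Gs) (i \in G))%N | i < n].

Lemma edge_prod_cat Gs Hs : edge_prod (Gs ++ Hs) = (edge_prod Gs + edge_prod Hs)%MM.
Proof. by apply/mnmP => i; rewrite mnmDE !mnmE big_cat. Qed.

Lemma edge_prod1 G : edge_prod [:: G] = sqfree_mnm G.
Proof. by apply/mnmP => i; rewrite !mnmE big_seq1. Qed.

Definition edge_power t (m : 'X_{1..n}) := exists Gs,
  [/\ size Gs = t, all (mem E) Gs & (edge_prod Gs <= m)%MM].

Fact edge_power0 m : edge_power 0 m.
Proof. by exists [::]; split=> //; apply/mnm_lepP => i; rewrite mnmE big_nil. Qed.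

Fact edge_powerD i j m m' :
  edge_power i m -> edge_power j m' -> edge_power (i + j) (m + m')%MM.
Proof.
move=> [Gs [<- EGs le]] [Gs' [<- EGs' le']]; exists (Gs ++ Gs').
rewrite size_cat all_cat EGs EGs' edge_prod_cat; split=> //.
by apply/mnm_lepP => v; rewrite !mnmDE leq_add // (mnm_lepP _).
Qed.

Fact edge_power_split i j m : edge_power (i + j) m ->
  exists m1 m2, [/\ m = (m1 + m2)%MM, edge_power i m1 & edge_power j m2].
Proof.
case=> Gs [sz EGs le]; move: EGs le.
rewrite -{1 2}(cat_take_drop i Gs) all_cat edge_prod_cat => /andP[E1 E2] le.
have le1 : (edge_prod (take i Gs) <= m)%MM by apply: lepm_trans le; apply: lem_addr.
exists (edge_prod (take i Gs)), (m - edge_prod (take i Gs))%MM; split.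
- by rewrite addmC submK.
- by exists (take i Gs); rewrite lepm_refl; split=> //; rewrite size_takel // sz leq_addr.
- exists (drop i Gs); rewrite E2 size_drop sz addKn; split=> //.
  apply/mnm_lepP => v; have := mnm_lepP le v; rewrite mnmDE mnmBE; lia.
Qed.

Definition edge_family : graded_family n := GradedFamily edge_power0 edge_powerD edge_power_split.

Lemma edge_idealE (k : fieldType) :
  edge_ideal E = monideal (edge_family 1%N) :> set {mpoly k[n]}.
Proof.
apply: ideal_span_monideal; first exact: level_up.
  move=> _ [F EF ->]; rewrite sqfreeE; apply: monidealX.
  by exists [:: F]; rewrite /= EF edge_prod1 lepm_refl.
move=> m [Gs [sz EGs le]]; case: Gs sz EGs le => [|G [|//]] // _ /andP[/= EG _].
rewrite edge_prod1 => le; exists (sqfree k G); first by exists G.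
by exists 'X_[m - sqfree_mnm G]; rewrite sqfreeE -mpolyXD submK.
Qed.

Lemma good_leaf_max F Gs : good_leaf E F -> Gs != [::] ->
    all (mem E) Gs -> F \notin Gs ->
  exists2 G, G \in Gs & forall H, H \in Gs -> F :&: H \subset F :&: G.
Proof.
move=> /andP[EF /forall_inP chain]; elim: Gs => // G [|G' Gs] IH _.
  by move=> _ _; exists G; rewrite ?inE // => H; rewrite inE => /eqP ->.
rewrite [all _ _]/= => /andP[EG EGs]; rewrite inE negb_or => /andP[neG nF].
have [H HGs Hmax] := IH isT EGs nF.
have EH : H \in E :\ F.
  rewrite !inE (_ : H \in E = true) ?andbT; last exact: (allP (EGs : all (mem E) (G' :: Gs)) _ HGs).
  by apply: contraNneq nF => <-.
have {}EG : G \in E :\ F by rewrite !inE EG andbT eq_sym.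
have /forall_inP/(_ _ EH)/orP[le|le] := chain _ EG.
  exists H; first by rewrite inE HGs orbT.
  by move=> H'; rewrite inE => /orP[/eqP-> //|/Hmax].
exists G; first by rewrite mem_head.
move=> H'; rewrite inE => /orP[/eqP-> //|/Hmax le'].
exact: fintype.subset_trans le' le.
Qed.

(** The colon [I^(t+1) : x_F] is [I^t]. The edge to remove from a product is [F]
    if it occurs, and otherwise one whose intersection with [F] is largest. *)
Lemma good_leaf_colon F t m : good_leaf E F ->
  edge_power t m <-> edge_power t.+1 (m + sqfree_mnm F)%MM.
Proof.
move=> leafF; split=> [h|[Gs [sz EGs le]]].
  rewrite -addn1; apply: edge_powerD h _; exists [:: F].
  by rewrite edge_prod1 lepm_refl /= (andP leafF).1.
have [G GGs hG] : exists2 G, G \in Gs &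
    forall v, ((\sum_(H <- rem G Gs) (v \in H)) <= m v)%N.
  (* Deleting [G] lowers the multiplicity by one on [G], which pays for [F] there;
     at a vertex of [F] outside [G] no edge of the product passes. *)
  have red G : G \in Gs ->
      (forall v, v \in F -> v \notin G -> forall H, H \in Gs -> v \notin H) ->
      forall v, ((\sum_(H <- rem G Gs) (v \in H)) <= m v)%N.
    move=> GGs hG v; have := mnm_lepP le v; rewrite mnmDE !mnmE.
    have [vF|vF] := boolP (v \in F); rewrite (perm_big _ (perm_to_rem GGs)) big_cons /=.
      have [vG|vG] := boolP (v \in G); first by lia.
      move=> _; rewrite big_seq big1 // => H /mem_rem HGs.
      by rewrite (negPf (hG v vF vG H HGs)).
    by lia.
  have [FGs|FGs] := boolP (F \in Gs).
    by exists F => //; apply: red => // v ->.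
  have [|G GGs Gmax] := good_leaf_max leafF _ EGs FGs; first by case: (Gs) sz.
  exists G => //; apply: red => // v vF vG H HGs; apply: contra vG => vH.
  by have /fintype.subsetP/(_ v) := Gmax H HGs; rewrite !inE vF vH => /(_ isT).
exists (rem G Gs); split.
- by rewrite size_rem // sz.
- by apply/allP => H /mem_rem /(allP EGs).
- by apply/mnm_lepP => v; rewrite mnmE; apply: hG.
Qed.
End EdgeIdeal.

(** * Integrality over a graded family through its Rees algebra *)

Section ReesAlgebra.
Variables (A : idomainType) (n : nat) (W : graded_family n).
Local Notation R := {mpoly A[n]}.

Lemma monideal0T (f : R) : monideal (W 0%N) f.
Proof. by move=> m _; apply: level0. Qed.

(** The Rees algebra as a set of polynomials in an auxiliary variable, whose
    coefficient of degree [i] lies in the [i]-th ideal of the family. *)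
Definition rees : {pred {poly R}} := fun p => `[< forall i, monideal (W i) p`_i >].

Lemma rees_subring : subring_closed rees.
Proof.
split=> [|p q|p q]; rewrite ?unfold_in.
- apply/asboolP => i; rewrite coef1; case: i => [|i]; [exact: monideal0T|exact: monideal0].
- move=> /asboolP hp /asboolP hq; apply/asboolP => i; rewrite coefB.
  by apply: monidealD => //; apply: monidealN.
- move=> /asboolP hp /asboolP hq; apply/asboolP => i; rewrite coefM.
  apply: monideal_sum => j _; apply: monidealM (hp j) (hq (i - j)%N) => m m' h1 h2.
  by have := levelD h1 h2; rewrite subnKC // -ltnS.
Qed.

HB.instance Definition _ := GRing.isSubringClosed.Build {poly R} rees rees_subring.

Record rees_alg := ReesElt { rees_val : {poly R}; _ : rees_val \in rees }.
HB.instance Definition _ := [isSub for rees_val].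
HB.instance Definition _ := [Choice of rees_alg by <:].
HB.instance Definition _ := [SubChoice_isSubComNzRing of rees_alg by <:].

(** Coefficients are taken in a domain, as the argument below leaves the base
    field for a polynomial ring over it. *)
Definition integral_over_level (f : R) := exists (d : nat) (a : nat -> R),
  [/\ (0 < d)%N, forall i, (1 <= i <= d)%N -> monideal (W i) (a i)
    & f ^+ d + \sum_(1 <= i < d.+1) a i * f ^+ (d - i) = 0].

Lemma rees_horner (p : {poly rees_alg}) (f : R) d : (size p <= d.+1)%N ->
  (map_poly (\val : rees_alg -> {poly R}) p).[f *: 'X] =
  \sum_(i < d.+1) f ^+ (d - i) *: (rees_val p`_(d - i) * 'X^(d - i)).
Proof.
move=> sz; rewrite (@horner_coef_wide _ d.+1); last exact: leq_trans (size_poly _ _) sz.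
rewrite (reindex_inj rev_ord_inj) /=; apply: eq_bigr => i _.
rewrite subSS exprZn -scalerAr; congr (_ *: (_ * _)).
by rewrite coef_map_id0.
Qed.

(** From an integral equation of [f] of degree [d], the multiples of its
    coefficients by powers of the auxiliary variable give one for [f *: 'X];
    conversely the homogeneous part of degree [d] of an equation of [f *: 'X]
    over the Rees algebra is an integral equation of [f]. *)
Lemma integral_levelP f : integral_over_level f <->
  integralOver (\val : rees_alg -> {poly R}) (f *: 'X).
Proof.
split=> [[d [a [d_gt0 ha fE]]]|[p p_monic /rootP p0]].
  (* [c 0 = 1] is the leading coefficient of the equation *)
  pose c (j : nat) : R := if j == 0%N then 1 else if (j <= d)%N then a j else 0.
  have c_rees j : c j *: 'X^j \in rees.
    apply/asboolP => i; rewrite coefZ coefXn mulr_natr mulrb.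
    case: eqP => [->|_]; last exact: monideal0.
    rewrite /c; case: eqP => [->|/eqP j0]; first exact: monideal0T.
    case: ifP => [jd|_]; last exact: monideal0.
    by apply: ha; rewrite lt0n j0.
  pose q : {poly rees_alg} := \poly_(j < d.+1) ReesElt (c_rees (d - j)%N).
  have q_size : size q = d.+1.
    apply: size_poly_eq; rewrite subnn -val_eqE /= /c eqxx expr0 scale1r.
    exact: oner_neq0.
  exists q.
    rewrite monicE lead_coefE q_size coef_poly ltnSn; apply/eqP/val_inj => /=.
    by rewrite subnn /c eqxx expr0 scale1r.
  apply/rootP; rewrite (@rees_horner _ _ d) ?q_size //.
  rewrite (eq_bigr (fun i : 'I_d.+1 => (c i * f ^+ (d - i)) *: 'X^d)); last first.
    move=> i _; rewrite coef_poly ltnS leq_subr /= subKn; last by rewrite -ltnS.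
    rewrite -scalerAl -exprD subnKC ?scalerA 1?mulrC //; by rewrite -ltnS.
  rewrite -scaler_suml big_ord_recl /= subn0 /c eqxx mul1r.
  rewrite big_add1 big_mkord in fE; rewrite -[RHS](scale0r 'X^d) -[in RHS]fE.
  by congr ((_ + _) *: _); apply: eq_bigr => i _; rewrite /bump /= add1n ltn_ord.
pose d := (size p).-1.
have p_size : size p = d.+1 by rewrite /d prednK // size_poly_gt0 monic_neq0.
have pd : rees_val p`_d = 1.
  by have := monicP p_monic; rewrite lead_coefE p_size /= => ->.
exists d, (fun i => (rees_val p`_(d - i))`_i); split.
- rewrite lt0n; apply/eqP => d0; move: p0; rewrite (@rees_horner _ _ d) ?p_size //.
  rewrite d0 big_ord1 subnn expr0 scale1r mulr1 -d0 pd; exact/eqP/oner_neq0.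
- by move=> i _; case: (p`_(d - i)) => q /= /asboolP; apply.
have := congr1 (fun q : {poly R} => q`_d) p0.
rewrite (@rees_horner _ _ d) ?p_size // coef0 coef_sum big_ord_recl /= => E; rewrite -[RHS]E {E}.
rewrite big_add1 big_mkord; congr (_ + _).
  by rewrite subn0 pd mul1r coefZ coefXn eqxx mulr1.
apply: eq_bigr => i _; rewrite /bump /= add1n coefZ coefMXn mulrC.
by rewrite ltnNge leq_subr /= subKn.
Qed.

Lemma integral_level0 : integral_over_level 0.
Proof.
exists 1%N, (fun=> 0); split=> // [i _|]; first exact: monideal0.
by rewrite expr1 add0r big1 // => i _; rewrite mul0r.
Qed.

Lemma integral_levelB f g :
  integral_over_level f -> integral_over_level g -> integral_over_level (f - g).
Proof.
move=> /integral_levelP hf /integral_levelP hg; apply/integral_levelP.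
by rewrite scalerBl; apply: integral_sub.
Qed.

Lemma integral_levelZ c f : integral_over_level f -> integral_over_level (c *: f).
Proof.
case=> d [a [d_gt0 ha fE]]; exists d, (fun i => c ^+ i *: a i); split=> //.
  by move=> i /ha; apply: monidealZ.
rewrite exprZn -[RHS](scaler0 _ (c ^+ d)) -[in RHS]fE scalerDr; congr (_ + _).
rewrite scaler_sumr; apply: eq_big_nat => i /andP[_ id].
by rewrite exprZn -scalerAr -scalerAl scalerA -exprD subnK.
Qed.

Lemma integral_level_monomial c d m : (0 < d)%N -> W d (m *+ d)%MM ->
  integral_over_level (c *: 'X_[m]).
Proof.
move=> d_gt0 Wm; apply: integral_levelZ.
exists d, (fun i => if i == d then - 'X_[m *+ d] else 0); split=> //.
  move=> i _; case: eqP => [->|_]; last exact: monideal0.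
  by apply: monidealN; apply: monidealX.
rewrite (big_nat_recr d) //= eqxx subnn expr0 mulr1 mpolyXn big_nat big1; last first.
  by move=> i /andP[_ id]; rewrite ltn_eqF // mul0r.
by rewrite add0r subrr.
Qed.

(** In an integral equation of [c x^m] of degree [d], the coefficient [c^d] of
    [x^(m d)] must be cancelled by a term of some [a_i (c x^m)^(d - i)], which
    has to come from the monomial [x^(m i)] of [a_i]. *)
Lemma monomial_integral_level c m : c != 0 -> integral_over_level (c *: 'X_[m]) ->
  exists2 d, (0 < d)%N & W d (m *+ d)%MM.
Proof.
move=> c0 [d [a [d_gt0 ha fE]]].
apply: contraPP fE => nW; apply/eqP.
have : (((c *: 'X_[m]) ^+ d + \sum_(1 <= i < d.+1) a i * (c *: 'X_[m]) ^+ (d - i)) : R)@_(m *+ d)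
   != 0; last by apply: contraNneq => ->; rewrite mcoeff0.
rewrite mcoeffD exprZn mpolyXn mcoeffZ mcoeffX eqxx mulr1 linear_sum /=.
rewrite big_nat big1 ?addr0 ?expf_neq0 // => i /andP[i_gt0 id].
rewrite exprZn mpolyXn -scalerAr mcoeffZ mcoeffMXE.
have -> : (m *+ d - m *+ (d - i) = m *+ i)%MM.
  by apply/mnmP => v; rewrite mnmBE !mulmnE -mulnBr subKn.
case: ifP => _; last by rewrite mulr0.
rewrite (memN_msupp_eq0 (_ : _ \notin _)) ?mulr0 //.
apply/negP => mi; apply: nW; exists i => //.
by apply: (ha i _ _ mi); rewrite i_gt0.
Qed.

End ReesAlgebra.

(** * Integral closures of powers of monomial ideals *)

Section Torus.
Variables (A : idomainType) (n : nat) (W : graded_family n) (u : 'I_n -> A).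

(** [Phi f - wt m' *: f] has lost the monomial [m'] and no other one, since [wt]
    is injective; repeating this leaves a single chosen monomial. *)
Lemma isolate_monomial (wt : 'X_{1..n} -> A)
    (Phi : {mpoly A[n]} -> {mpoly A[n]}) (P : {mpoly A[n]} -> Prop) f m :
    injective wt -> (forall f m, (Phi f)@_m = f@_m * wt m) ->
    (forall f g, P f -> P g -> P (f - g)) -> (forall c f, P f -> P (c *: f)) ->
    (forall f, P f -> P (Phi f)) ->
  P f -> m \in msupp f -> exists2 c, c != 0 & P (c *: 'X_[m]).
Proof.
move=> wt_inj PhiE PB PZ PPhi.
have [N] := ubnP (size (msupp f)); elim: N f => // N IHN f ltN Pf mf.
have [/hasP[m' m'f ne]|/hasPn only] := boolP (has (predC1 m) (msupp f)); last first.
  exists f@_m; first by rewrite -mcoeff_msupp.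
  suff -> : f@_m *: 'X_[m] = f by [].
  apply/mpolyP => q; rewrite mcoeffZ mcoeffX.
  case: eqP => [->|neq]; rewrite ?mulr1 ?mulr0 //.
  have [/only/=|/memN_msupp_eq0-> //] := boolP (q \in msupp f).
  by rewrite negbK => /eqP/esym.
pose g := Phi f - wt m' *: f.
have gE q : g@_q = f@_q * (wt q - wt m').
  by rewrite mcoeffB PhiE mcoeffZ mulrBr (mulrC (wt m')).
apply: (IHN g).
- apply: (@leq_trans (size (msupp f))); last exact: ltN.
  rewrite (perm_size (perm_to_rem m'f)) /= ltnS.
  apply: uniq_leq_size (msupp_uniq _) _ => q.
  rewrite mem_rem_uniq ?msupp_uniq // !inE !mcoeff_msupp gE mulf_eq0 negb_or subr_eq0.
  by case/andP=> -> ne'; rewrite andbT; apply: contraNneq ne' => ->.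
- by apply: PB; [exact: PPhi|exact: PZ].
- rewrite mcoeff_msupp gE mulf_neq0 -?mcoeff_msupp // subr_eq0.
  by apply: contraNneq ne => /wt_inj ->.
Qed.

Definition torus : {mpoly A[n]} -> {mpoly A[n]} :=
  mmap (@mpolyC n A) (fun i => u i *: 'X_i).

Lemma mcoeff_torus f m : (torus f)@_m = f@_m * mmap1 u m.
Proof.
have mmap1E q : mmap1 (fun i => u i *: 'X_i : {mpoly A[n]}) q = mmap1 u q *: 'X_[q].
  rewrite /mmap1; under eq_bigr do rewrite exprZn.
  by rewrite scaler_prod -!mpolyXE_id.
rewrite /torus /mmap linear_sum /=.
under eq_bigr do rewrite mmap1E mul_mpolyC !mcoeffZ mcoeffX.
have [mf|nmf] := boolP (m \in msupp f).
  rewrite (bigD1_seq m) ?msupp_uniq //= eqxx mulr1 big1 ?addr0 // => q /negPf ->.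
  by rewrite !mulr0.
rewrite (memN_msupp_eq0 nmf) mul0r big_seq big1 // => q qf.
by case: eqP qf nmf => [->->//|]; rewrite !mulr0.
Qed.

Lemma monideal_torus S (f : {mpoly A[n]}) : monideal S f -> monideal S (torus f).
Proof.
move=> hf m; rewrite mcoeff_msupp mcoeff_torus => h; apply: hf.
by rewrite mcoeff_msupp; apply: contraNneq h => ->; rewrite mul0r.
Qed.

Lemma integral_level_torus f : integral_over_level W f -> integral_over_level W (torus f).
Proof.
case=> d [a [d_gt0 ha fE]]; exists d, (fun i => torus (a i)); split; first exact: d_gt0.
  by move=> i /ha; apply: monideal_torus.
rewrite -[RHS](rmorph0 torus) -[in RHS]fE rmorphD rmorphXn rmorph_sum /=.
by congr (_ + _); apply: eq_bigr => i _; rewrite rmorphM rmorphXn.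
Qed.
End Torus.

Section IntegralClosure.
Variables (k : fieldType) (n : nat) (W : graded_family n).
Local Notation R := {mpoly k[n]}.

Lemma integral_level_ext (A : idomainType) (h : {rmorphism k -> A}) (f : R) :
  integral_over_level W f -> integral_over_level W (map_mpoly h f).
Proof.
case=> d [a [d_gt0 ha fE]]; exists d, (fun i => map_mpoly h (a i)); split; first exact: d_gt0.
  move=> i /ha hai m; rewrite mcoeff_msupp mcoeff_map_mpoly => hm; apply: hai.
  by rewrite mcoeff_msupp; apply: contraNneq hm => ->; rewrite raddf0.
rewrite -[RHS](rmorph0 (map_mpoly h)) -[in RHS]fE rmorphD rmorphXn rmorph_sum /=.
by congr (_ + _); apply: eq_bigr => i _; rewrite rmorphM rmorphXn.
Qed.

(** The exponents of the monomials integral over the first ideal of the family. *)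
Definition integral_level (m : 'X_{1..n}) := exists2 d, (0 < d)%N & W d (m *+ d)%MM.

(** [isolate_monomial] is used over [{mpoly k[n]}] with generic parameters
    [u_i = 'X_i], for which distinct monomials have distinct weights. *)
Lemma integral_closure_level :
  integral_closure (monideal (W 1%N) : set R) = monideal integral_level.
Proof.
have -> : integral_closure (monideal (W 1%N) : set R) = integral_over_level W (A := k).
  apply/predeqP => f; split=> -[d [a [d_gt0 ha fE]]]; exists d, a; split=> // i /ha;
    by rewrite ideal_exp_level.
apply/predeqP => f; split=> [hf m mf|hf].
  pose X i : R := 'X_i.
  have X_inj : injective (mmap1 X).
    move=> m1 m2; rewrite !mmap1_id => E.
    by move: (msuppX k m1); rewrite E msuppX => -[].
  have mf' : m \in msupp (map_mpoly (@mpolyC n k) f).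
    by rewrite mcoeff_msupp mcoeff_map_mpoly mpolyC_eq0 -mcoeff_msupp.
  have [c c0] := isolate_monomial X_inj (@mcoeff_torus _ _ X) (@integral_levelB _ _ W)
    (@integral_levelZ _ _ W) (@integral_level_torus _ _ W X)
    (integral_level_ext (@mpolyC n k) hf) mf'.
  exact: monomial_integral_level.
rewrite (mpolyE f); have : all (mem (msupp f)) (msupp f) by apply/allP.
elim: {-1}(msupp f) => [_|m s IHs /= /andP[mf /IHs hs]].
  by rewrite big_nil; apply: integral_level0.
rewrite big_cons -[X in _ + X]opprK; apply: integral_levelB.
  by have [d] := hf m mf; apply: integral_level_monomial.
by rewrite -scaleN1r; apply: integral_levelZ.
Qed.

Lemma integral_level_up : upclosed integral_level.
Proof.
move=> m m' [d d_gt0 Wm]; exists d => //.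
have -> : ((m + m') *+ d = m *+ d + m' *+ d)%MM.
  by apply/mnmP => i; rewrite !(mnmDE, mulmnE) mulnDl.
exact: level_up.
Qed.
End IntegralClosure.

(** * Depth and regularity of powers of edge ideals with a good leaf *)

Section GoodLeafShift.
Variables (n : nat) (E : {set {set 'I_n}}) (F : {set 'I_n}).
Hypothesis leafF : good_leaf E F.

Lemma good_leaf_colonX t d m :
  edge_power E t m <-> edge_power E (t + d) (m + sqfree_mnm F *+ d)%MM.
Proof.
elim: d t m => [|d IHd] t m; first by rewrite addn0 mulm0n addm0.
rewrite (good_leaf_colon t m leafF) (IHd t.+1) addSnnS.
by rewrite mulmS addmA.
Qed.

Lemma good_leaf_integral_colon t m :
  integral_level (veronese (edge_family E) t) m <->
  integral_level (veronese (edge_family E) t.+1) (m + sqfree_mnm F)%MM.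
Proof.
have colon d : edge_power E (t * d) (m *+ d)%MM <->
    edge_power E (t.+1 * d) ((m + sqfree_mnm F) *+ d)%MM.
  rewrite (good_leaf_colonX _ d) addnC -mulSn.
  suff -> : (m *+ d + sqfree_mnm F *+ d = (m + sqfree_mnm F) *+ d)%MM by [].
  by apply/mnmP => i; rewrite !(mnmDE, mulmnE) mulnDl.
by split=> -[d d_gt0 /colon]; exists d.
Qed.

End GoodLeafShift.

Theorem theorem5p1 (k : fieldType) (n : nat) (E : {set {set 'I_n}})
    (hE : exists F, good_leaf E F) :
  let I : set {mpoly k[n]} := edge_ideal E in
  ((forall s t : nat, (1 <= s)%N -> (s <= t)%N ->
      (depth_quot (ideal_exp I t) <= depth_quot (ideal_exp I s))%E)
   /\
   (forall s t : nat, (1 <= s)%N -> (s <= t)%N ->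
      (depth_quot (integral_closure (ideal_exp I t))
         <= depth_quot (integral_closure (ideal_exp I s)))%E))
  /\
  ((forall s t : nat, (1 <= s)%N -> (s <= t)%N ->
      (reg_quot (ideal_exp I s) <= reg_quot (ideal_exp I t))%E)
   /\
   (forall s t : nat, (1 <= s)%N -> (s <= t)%N ->
      (reg_quot (integral_closure (ideal_exp I s))
         <= reg_quot (integral_closure (ideal_exp I t)))%E)).
Proof.
have [F leafF] := hE => I; pose W := edge_family E.
have powE t : ideal_exp I t = monideal (W t).
  by rewrite /I edge_idealE ideal_exp_level.
have clE t : integral_closure (ideal_exp I t) = monideal (integral_level (veronese W t)).
  by rewrite powE -integral_closure_level /= muln1.
have noninc (f : nat -> \bar int) : (forall t, (f t.+1 <= f t)%E) ->
    forall s t, (1 <= s)%N -> (s <= t)%N -> (f t <= f s)%E.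
  move=> fS s t _; move: s t.
  by apply: (@homo_leq _ f (fun x y => (y <= x)%E)) => // y x z /[swap]; apply: le_trans.
have nondec (f : nat -> \bar int) : (forall t, (f t <= f t.+1)%E) ->
    forall s t, (1 <= s)%N -> (s <= t)%N -> (f s <= f t)%E.
  move=> fS s t _; move: s t.
  by apply: (@homo_leq _ f (fun x y => (x <= y)%E)) => // y x z; apply: le_trans.
have colon t m : W t m <-> W t.+1 (m + sqfree_mnm F)%MM by apply: good_leaf_colon.
have int_colon := good_leaf_integral_colon leafF.
split; split.
- apply: (noninc (fun t => depth_quot (ideal_exp I t))) => t; rewrite !powE.
  by apply: shift_depth_le (colon t); apply: level_up.
- apply: (noninc (fun t => depth_quot (integral_closure (ideal_exp I t)))) => t.
  by rewrite !clE; apply: shift_depth_le (int_colon t); apply: integral_level_up.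
- apply: (nondec (fun t => reg_quot (ideal_exp I t))) => t; rewrite !powE.
  by apply: shift_reg_le (colon t); apply: level_up.
- apply: (nondec (fun t => reg_quot (integral_closure (ideal_exp I t)))) => t.
  by rewrite !clE; apply: shift_reg_le (int_colon t); apply: integral_level_up.
Qed.
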